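(* Let $\mathcal{A}^c_D=\{m\in\mathcal{A}^c:\mathrm{Disc}(D_m)\ne0\}$. The map $$\hat D:\mathcal{A}^c_D/(SL(V)\times SL(V))\to S^2(V^* )_{\mathrm{n.d.}}/SL(V),\qquad \hat D_{[m]}=[D_m],$$ is a bijection.
   Context: $\mathbb{F}$ is a field of characteristic different from $2$ and $3$, and $V$ is a two-dimensional $\mathbb{F}$-vector space. $\mathcal{A}^c$ is the set of symmetric bilinear maps $m:V\times V\to V$. For $m\in\mathcal{A}^c$, $D_m$ is the quadratic form on $V$ given by $D_m(v)=\det(L_v)$, where $L_v(w)=m(v,w)$. For a quadratic form $q(xe_1+ye_2)=\alpha x^2+\beta xy+\gamma y^2$ in a basis $(e_1,e_2)$ with dual basis $(\epsilon_1,\epsilon_2)$, $\mathrm{Disc}(q)=(\beta^2-4\alpha\gamma)(\epsilon_1\wedge\epsilon_2)^{\otimes2}\in\Lambda^2(V^* )^{\otimes2}$. $S^2(V^* )_{\mathrm{n.d.}}$ is the set of non-degenerate quadratic forms on $V$, i.e. those with nonzero discriminant. $SL(V)\times SL(V)$ acts on $\mathcal{A}^c$ by $({}^{(g_1,g_2)}m)(u,v)=g_1\,m(g_2^{-1}u,g_2^{-1}v)$, and $SL(V)$ acts on quadratic forms by $(g\cdot q)(u)=q(g^{-1}u)$. Since $D_{{}^{(g_1,g_2)}m}=g_2\cdot D_m$, the map $m\mapsto D_m$ induces the map $\hat D$ on orbits. *)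

(* Defs.v *)
From HB Require Import structures.
From mathcomp Require Import all_boot all_order all_algebra.
From mathcomp Require Import boolp classical_sets functions ring.

Set Implicit Arguments.
Unset Strict Implicit.
Unset Printing Implicit Defensive.
Import GRing.Theory passmx.
Local Open Scope ring_scope.
Local Open Scope classical_set_scope.

Section Defs.
Context {F : fieldType} {V : vectType F}.

Definition lfun_det (f : 'End(V)) : F :=
  \det (mxof (vbasis {:V}) (vbasis {:V}) f).

Lemma lfun_detE (e : (\dim {:V}).-tuple V) (f : 'End(V)) :
  basis_of {:V} e -> \det (mxof e e f) = lfun_det f.
Proof.
move=> be; set b := vbasis {:V}; have bb : basis_of {:V} b := vbasisP _.
have PQ : mxof e b \1%VF *m mxof b e \1%VF = 1%:M.
  by rewrite -mxof_comp // comp_lfun1r mxof1 ?(basis_free be).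
have -> : mxof e e f = mxof e b \1%VF *m mxof b b f *m mxof b e \1%VF.
  by rewrite -!mxof_comp // comp_lfun1r comp_lfun1l.
by rewrite !det_mulmx mulrAC -det_mulmx PQ det1 mul1r.
Qed.

Definition SL : set 'End(V) := [set g | lfun_det g = 1].

(* A bilinear map m : V x V -> V is encoded in curried form, so that m v is the
   operator L_v of left multiplication by v. *)
Definition comm_algs : set 'Hom(V, 'End(V)) :=
  [set m : 'Hom(V, 'End(V)) | forall u v, m u v = m v u].

Definition Dform (m : 'Hom(V, 'End(V))) : V -> F := fun v => lfun_det (m v).

(* g^-1 is the inverse of g as soon as g is bijective, e.g. for g in SL. *)
Definition alg_act (g1 g2 : 'End(V)) (m : 'Hom(V, 'End(V))) :
    'Hom(V, 'End(V)) :=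
  linfun (fun u => g1 \o m (g2^-1 u) \o g2^-1)%VF.

Lemma alg_actE g1 g2 m u v :
  alg_act g1 g2 m u v = g1 (m (g2^-1%VF u) (g2^-1%VF v)).
Proof.
have lin : linear (fun u => g1 \o m (g2^-1 u) \o g2^-1)%VF.
  move=> a x y; apply/lfunP => w.
  by do !rewrite ?lfunE ?linearP /=.
pose L := GRing.isLinear.Build _ _ _ _ _ lin.
pose f : {linear V -> 'End(V)} :=
  HB.pack (fun u => g1 \o m (g2^-1 u) \o g2^-1)%VF L.
by rewrite /alg_act (lfunE f) /= !lfunE /= !lfunE.
Qed.

Definition form_act (g : 'End(V)) (q : V -> F) : V -> F :=
  fun u => q (g^-1%VF u).

Definition quad_forms : set (V -> F) :=
  [set q | exists b : 'Hom(V, 'Hom(V, F^o)), forall v, q v = b v v].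

(* Elements of the tensor square of the second exterior power of V^* are
   represented by the corresponding 4-linear functions on V. *)
Definition wedge (f g : V -> F) : V -> V -> F :=
  fun u v => f u * g v - f v * g u.

Definition tensor_sq (w : V -> V -> F) : V -> V -> V -> V -> F :=
  fun u1 u2 v1 v2 => w u1 u2 * w v1 v2.

(* If q (x e1 + y e2) = alpha x^2 + beta x y + gamma y^2, then alpha = q e1,
   gamma = q e2 and alpha + beta + gamma = q (e1 + e2); see [quad_formE]. *)
Definition disc_coef (e1 e2 : V) (q : V -> F) : F :=
  (q (e1 + e2) - q e1 - q e2) ^+ 2 - 4%:R * q e1 * q e2.

Definition Disc_in (e : 2.-tuple V) (q : V -> F) : V -> V -> V -> V -> F :=
  fun u1 u2 v1 v2 =>
    disc_coef (tnth e 0) (tnth e 1) q *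
    tensor_sq (wedge (coord e 0) (coord e 1)) u1 u2 v1 v2.

(* When V has dimension 2 this is vbasis {:V}, reindexed by 'I_2. *)
Definition vbasis2 : 2.-tuple V :=
  [tuple (vbasis {:V})`_0; (vbasis {:V})`_1].

Definition Disc := Disc_in vbasis2.

Lemma quad_formE (q : V -> F) (e1 e2 : V) (x y : F) : quad_forms q ->
  q (x *: e1 + y *: e2) =
    q e1 * x ^+ 2 + (q (e1 + e2) - q e1 - q e2) * (x * y) + q e2 * y ^+ 2.
Proof.
case=> b qE; rewrite !qE.
have bDl u v w : b (u + v) w = b u w + b v w by rewrite linearD lfunE.
have bZl a u w : b (a *: u) w = a * b u w by rewrite linearZ lfunE.
have bZr a u w : b w (a *: u) = a * b w u by rewrite linearZ.
rewrite !bDl !linearD /= !bZl !bZr; ring.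
Qed.

Lemma vbasis2P : \dim {:V} = 2%N -> basis_of {:V} vbasis2.
Proof.
move=> dV; have -> : (vbasis2 : seq V) = vbasis {:V}; last exact: vbasisP.
have : size (vbasis {:V}) = 2%N by rewrite size_tuple.
by rewrite /vbasis2 /=; case: (tval (vbasis {:V})) => [|a [|c []]].
Qed.

Lemma Disc_inE (e : 2.-tuple V) (q : V -> F) :
  basis_of {:V} e -> quad_forms q -> Disc_in e q = Disc q.
Proof.
move=> be Qq; have dV : \dim {:V} = 2%N by rewrite (size_basis be).
have bb := vbasis2P dV; rewrite /Disc; move: vbasis2 bb => b bb.
have dec (c : 2.-tuple V) (bc : basis_of {:V} c) v :
    v = coord c 0 v *: tnth c 0 + coord c 1 v *: tnth c 1.
  rewrite {1}(coord_basis bc (memvf v)) !big_ord_recl big_ord0 addr0 !(tnth_nth 0) /=.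
  by have -> : lift ord0 ord0 = 1 :> 'I_2 by apply: val_inj.
apply/funext => u1; apply/funext => u2; apply/funext => v1; apply/funext => v2.
pose p i := coord b i (tnth e 0); pose r i := coord b i (tnth e 1).
have cE i v : coord b i v = coord e 0 v * p i + coord e 1 v * r i.
  by rewrite {1}(dec _ be v) linearD !linearZ.
have e0 : tnth e 0 = p 0 *: tnth b 0 + p 1 *: tnth b 1 := dec _ bb _.
have e1 : tnth e 1 = r 0 *: tnth b 0 + r 1 *: tnth b 1 := dec _ bb _.
have e01 : tnth e 0 + tnth e 1 =
    (p 0 + r 0) *: tnth b 0 + (p 1 + r 1) *: tnth b 1.
  by rewrite e0 e1 !scalerDl addrACA.
rewrite /Disc_in /disc_coef /tensor_sq /wedge !cE e01 e0 e1.
rewrite !quad_formE //; ring.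
Qed.

Definition algs_D : set 'Hom(V, 'End(V)) :=
  comm_algs `&` [set m : 'Hom(V, 'End(V)) | Disc (Dform m) <> 0].

Definition quad_forms_nd : set (V -> F) :=
  quad_forms `&` [set q | Disc q <> 0].

Definition alg_orbit (m : 'Hom(V, 'End(V))) : set 'Hom(V, 'End(V)) :=
  [set alg_act g.1 g.2 m | g in SL `*` SL].

Definition form_orbit (q : V -> F) : set (V -> F) :=
  [set form_act g q | g in SL].

Definition algs_D_quot : set (set 'Hom(V, 'End(V))) := alg_orbit @` algs_D.

Definition quad_forms_nd_quot : set (set (V -> F)) :=
  form_orbit @` quad_forms_nd.

(* The map induced by Dform on orbits; it sends alg_orbit m to
   form_orbit (Dform m). *)
Definition Dhat (O : set 'Hom(V, 'End(V))) : set (V -> F) :=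
  \bigcup_(m in O) form_orbit (Dform m).

End Defs.

Arguments SL {F} V.
Arguments comm_algs {F} V.
Arguments quad_forms {F} V.
Arguments algs_D {F} V.
Arguments quad_forms_nd {F} V.
Arguments algs_D_quot {F} V.
Arguments quad_forms_nd_quot {F} V.

(* Main.v *)
Require Import Defs.
From HB Require Import structures.
From mathcomp Require Import all_boot all_order all_algebra.
From mathcomp Require Import boolp classical_sets functions.
From mathcomp Require Import ring.

Set Implicit Arguments.
Unset Strict Implicit.
Unset Printing Implicit Defensive.
Import GRing.Theory passmx.
Local Open Scope ring_scope.
Local Open Scope classical_set_scope.

(** In a basis (e_0, e_1) of V a commutative algebra m is the triple of vectors
    a = m(e_0, e_0), b = m(e_0, e_1), c = m(e_1, e_1), that is, a 2 x 3 matrix,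
    and D_m(x e_0 + y e_1) = (x a + y b) /\ (x b + y c) has the three maximal
    minors a /\ b, a /\ c, b /\ c of this matrix as coefficients.  The factor
    g_1 multiplies the matrix on the left.  The theorem thus comes down to the
    classical fact that a 2 x 3 matrix of rank 2 is determined up to left
    multiplication by SL_2 by its maximal minors, and that these minors can be
    prescribed at will: the Pluecker relations of Gr(2, 3) are void.

    Both halves are obtained in a basis whose first vector e_0 satisfies
    q(e_0) <> 0, where q = D_m is the form at hand; such a basis exists because
    q is not identically zero ([quad_form_basis]).

    - Uniqueness ([Dform_inj]).  If D_m = D_m', then det L_(e_0) is the same
      nonzero scalar for m and m', so g = L'_(e_0) \o L_(e_0)^-1 lies in SL(V).
      Replacing m by (g, 1).m does not change D_m and makes L_(e_0) equal to
      L'_(e_0), which leaves only c to be compared with c'.  The other two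
      coefficients of the form say that c - c' has zero area with both a and b,
      which are independent, whence c = c' ([comm_algs_ext_Dform]).

    - Existence ([comm_algs_with_Dform]).  For q with coefficients alpha, beta,
      gamma, where alpha <> 0, take a = e_0, b = alpha e_1 and solve for c.

    Passing to orbits uses only that D is equivariant for the projection
    (g_1, g_2) |-> g_2 ([Dform_act]): if D_m' = g.D_m, then m' and (1, g).m
    have the same form, hence differ by some (h, 1). *)

(** * Bilinear maps as curried linear maps *)

Section Bilinear.
Context {F : fieldType} {V W : vectType F}.

Lemma bilinear_lfun (B : V -> V -> W) :
  (forall v, linear (B^~ v)) -> (forall u, linear (B u)) ->
  exists m : 'Hom(V, 'Hom(V, W)), forall u v, m u v = B u v.
Proof.
move=> linl linr.
pose Br u : {linear V -> W} :=
  HB.pack (B u) (GRing.isLinear.Build _ _ _ _ (B u) (linr u)).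
have BrE u v : linfun (Br u) v = B u v by rewrite lfunE.
have linBr : linear (fun u => linfun (Br u)).
  by move=> a u v; apply/lfunP => w; rewrite add_lfunE scale_lfunE !BrE linl.
pose Bl : {linear V -> 'Hom(V, W)} :=
  HB.pack (fun u => linfun (Br u)) (GRing.isLinear.Build _ _ _ _ _ linBr).
by exists (linfun Bl) => u v; rewrite lfunE BrE.
Qed.

End Bilinear.

(** * The group SL(V) *)

Section SpecialLinear.
Context {F : fieldType} {V : vectType F}.
Implicit Types f g : 'End(V).

Lemma lfun_detM f g : lfun_det (f \o g)%VF = lfun_det f * lfun_det g.
Proof. by rewrite /lfun_det (mxof_comp _ _ (vbasisP _)) det_mulmx mulrC. Qed.

Lemma lfun_det1 : lfun_det (\1%VF : 'End(V)) = 1.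
Proof. by rewrite /lfun_det mxof1 ?det1 // (basis_free (vbasisP _)). Qed.

(** A vector killed by f has coordinates killed by an invertible matrix. *)
Lemma lfun_det_lker0 f : lfun_det f != 0 -> lker f == 0%VS.
Proof.
move=> df; apply/lker0P/raddf_inj => u /= fu0.
have b := vbasisP {:V}.
apply/eqP; rewrite -(rVof_eq0 b); apply/eqP.
have uM : mxof (vbasis {:V}) (vbasis {:V}) f \in unitmx by rewrite unitmxE unitfE.
by rewrite -[LHS](mulmxK uM) -(rVof_app _ b) fu0 linear0 mul0mx.
Qed.

Lemma SL_lker0 g : SL V g -> lker g == 0%VS.
Proof. by move=> dg; apply: lfun_det_lker0; rewrite dg oner_neq0. Qed.

Lemma SL1 : SL V \1%VF.
Proof. exact: lfun_det1. Qed.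

Lemma SLM f g : SL V f -> SL V g -> SL V (f \o g)%VF.
Proof. by rewrite /SL /= lfun_detM => -> ->; rewrite mulr1. Qed.

Lemma lfun_detV f : lfun_det f != 0 -> lfun_det f^-1%VF = (lfun_det f)^-1.
Proof.
move=> df; apply: (mulfI df); rewrite mulfV // -lfun_detM.
by rewrite lker0_compfV ?lfun_det1 // lfun_det_lker0.
Qed.

Lemma SLV g : SL V g -> SL V g^-1%VF.
Proof. by rewrite /SL /= => dg; rewrite lfun_detV dg ?invr1 ?oner_neq0. Qed.

(** The inverse of a linear map is a genuine inverse only for bijective maps, and
    the composition rule needs both factors to be so. *)
Lemma inv_lfun_comp f g u : SL V f -> SL V g ->
  (f \o g)^-1%VF u = g^-1%VF (f^-1%VF u).
Proof.
move=> Sf Sg; apply: (can_inj (lker0_lfunK (SL_lker0 (SLM Sf Sg)))).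
by rewrite (lker0_lfunVK (SL_lker0 (SLM Sf Sg))) comp_lfunE !lker0_lfunVK ?SL_lker0.
Qed.

Lemma inv_lfun1 (u : V) : \1^-1%VF u = u.
Proof. by rewrite -{2}(lker0_lfunVK (SL_lker0 SL1) u) id_lfunE. Qed.

End SpecialLinear.

(** * The two actions and the equivariance of the determinant form *)

Section Actions.
Context {F : fieldType} {V : vectType F}.
Implicit Types (g h : 'End(V)) (m : 'Hom(V, 'End(V))) (q : V -> F).

Lemma alg_ext m m' : (forall u v, m u v = m' u v) -> m = m'.
Proof. by move=> mE; apply/lfunP => u; apply/lfunP => v. Qed.

Lemma alg_act1 m : alg_act \1%VF \1%VF m = m.
Proof. by apply: alg_ext => u v; rewrite alg_actE id_lfunE !inv_lfun1. Qed.

Lemma alg_actM g1 g2 h1 h2 m : SL V g2 -> SL V h2 ->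
  alg_act g1 g2 (alg_act h1 h2 m) = alg_act (g1 \o h1)%VF (g2 \o h2)%VF m.
Proof.
move=> Sg Sh; apply: alg_ext => u v.
by rewrite !alg_actE !inv_lfun_comp // lfunE.
Qed.

Lemma form_act1 q : form_act \1%VF q = q.
Proof. by apply/funext => u; rewrite /form_act inv_lfun1. Qed.

Lemma form_actM g h q : SL V g -> SL V h ->
  form_act g (form_act h q) = form_act (g \o h)%VF q.
Proof. by move=> Sg Sh; apply/funext => u; rewrite /form_act inv_lfun_comp. Qed.

Lemma comm_algs_act g1 g2 m : comm_algs V m -> comm_algs V (alg_act g1 g2 m).
Proof. by move=> cm u v; rewrite !alg_actE cm. Qed.

(** The operator L_v of the transformed algebra is
    g1 \o L_(g2^-1 v) \o g2^-1, so only g2 is seen by the determinant. *)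
Lemma Dform_act g1 g2 m : SL V g1 -> SL V g2 ->
  Dform (alg_act g1 g2 m) = form_act g2 (Dform m).
Proof.
move=> Sg1 Sg2; apply/funext => v; rewrite /form_act /Dform.
have -> : alg_act g1 g2 m v = (g1 \o (m (g2^-1 v) \o g2^-1))%VF.
  by apply/lfunP => w; rewrite alg_actE !lfunE /= lfunE.
by rewrite !lfun_detM [lfun_det g1]Sg1 (SLV Sg2 : lfun_det _ = 1) mul1r mulr1.
Qed.

(** Any element of the orbit of m can be reached from (g1, g2).m by first
    undoing (g1, g2). *)
Lemma alg_orbit_act m g1 g2 : SL V g1 -> SL V g2 ->
  alg_orbit (alg_act g1 g2 m) = alg_orbit m.
Proof.
move=> Sg1 Sg2; apply/seteqP; split => _ [[h1 h2] /= [Sh1 Sh2] <-].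
  by exists (h1 \o g1, h2 \o g2)%VF; rewrite /= ?alg_actM //; split; apply: SLM.
exists (h1 \o g1^-1, h2 \o g2^-1)%VF.
  by split; apply: SLM => //; apply: SLV.
rewrite /= alg_actM //; last by apply: SLM => //; apply: SLV.
by rewrite -!comp_lfunA !lker0_compVf ?SL_lker0 // !comp_lfun1r.
Qed.

Lemma form_orbit_act q g : SL V g -> form_orbit (form_act g q) = form_orbit q.
Proof.
move=> Sg; apply/seteqP; split => _ [h Sh <-].
  by exists (h \o g)%VF; rewrite ?form_actM //; apply: SLM.
exists (h \o g^-1)%VF; first by apply: SLM => //; apply: SLV.
rewrite form_actM //; last by apply: SLM => //; apply: SLV.
by rewrite -comp_lfunA lker0_compVf ?SL_lker0 // comp_lfun1r.
Qed.

Lemma form_orbit_refl q : form_orbit q q.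
Proof. by exists \1%VF; [exact: SL1 | rewrite form_act1]. Qed.

(** By equivariance, the forms of all the algebras in the orbit of m have one and
    the same orbit, so the union defining [Dhat] has a single value. *)
Lemma Dhat_orbit m : Dhat (alg_orbit m) = form_orbit (Dform m).
Proof.
apply/seteqP; split => [q [_ [[g1 g2] /= [Sg1 Sg2] <-]]|q qm].
  by rewrite Dform_act // form_orbit_act.
exists m => //; exists (\1, \1)%VF; last exact: alg_act1.
by split; apply: SL1.
Qed.

End Actions.

(** * Areas in a plane and determinant forms *)

(** The matrix is written out entrywise so that the length of the basis can then
    be rewritten from the dimension of V to the numeral 2. *)
Lemma lfun_det_coord (F : fieldType) (V : vectType F)
    (e : (\dim {:V}).-tuple V) (f : 'End(V)) : basis_of {:V} e ->
  lfun_det f = \det (\matrix_(i, j) coord e j (f e`_i)).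
Proof.
move=> be; rewrite -(lfun_detE _ be); congr (\det _); apply/matrixP => i j.
by rewrite !mxE /= vecof_delta.
Qed.

Section Plane.
Context {F : fieldType} {V : vectType F}.
Variable e : 2.-tuple V.
Hypothesis basis_e : basis_of {:V} e.

Let e0 := tnth e 0.
Let e1 := tnth e 1.

Definition area : V -> V -> F := wedge (coord e 0) (coord e 1).

Lemma coord_basis2 v : v = coord e 0 v *: e0 + coord e 1 v *: e1.
Proof.
rewrite {1}(coord_basis basis_e (memvf v)) !big_ord_recl big_ord0 addr0.
rewrite /e0 /e1 !(tnth_nth 0) /=.
by have -> : lift ord0 ord0 = 1 :> 'I_2 by apply: val_inj.
Qed.

Lemma plane_ext u v :
  coord e 0 u = coord e 0 v -> coord e 1 u = coord e 1 v -> u = v.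
Proof. by move=> uv0 uv1; rewrite (coord_basis2 u) uv0 uv1 -coord_basis2. Qed.

Lemma area_linearl v : linear (area^~ v : V -> F^o).
Proof.
move=> a u u'; rewrite /area /wedge !linearD !linearZ /=.
by rewrite /GRing.scale /=; ring.
Qed.

Lemma area_linearr u : linear (area u : V -> F^o).
Proof.
move=> a v v'; rewrite /area /wedge !linearD !linearZ /=.
by rewrite /GRing.scale /=; ring.
Qed.

(** Cramer's rule for expanding d on (a, b), with denominators cleared; it is also
    the three-term Pluecker identity for vectors of a plane. *)
Lemma area_cramer a b d : area a b *: d = area d b *: a + area a d *: b.
Proof.
by apply: plane_ext; rewrite linearD !linearZ /= /area /wedge; ring.
Qed.

Lemma lfun_det_area f : lfun_det f = area (f e0) (f e1).
Proof.
have dV : \dim {:V} = 2%N := size_basis basis_e.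
move: (@lfun_det_coord F V); rewrite dV => detE; rewrite (detE e) //.
rewrite (expand_det_row _ 0) !big_ord_recl big_ord0 addr0 /cofactor !det_mx11 !mxE /=.
have -> : lift ord0 0 = 1 :> 'I_2 by apply: val_inj.
have -> : lift 1 0 = 0 :> 'I_2 by apply: val_inj.
by rewrite /area /wedge /e0 /e1 !(tnth_nth 0) /= /bump /= expr0 expr1; ring.
Qed.

Lemma coord_e00 : coord e 0 e0 = 1.
Proof. by rewrite /e0 (tnth_nth 0) (coord_free 0 0 (basis_free basis_e)). Qed.

Lemma coord_e01 : coord e 0 e1 = 0.
Proof. by rewrite /e1 (tnth_nth 0) (coord_free 1 0 (basis_free basis_e)). Qed.

Lemma coord_e10 : coord e 1 e0 = 0.
Proof. by rewrite /e0 (tnth_nth 0) (coord_free 0 1 (basis_free basis_e)). Qed.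

Lemma coord_e11 : coord e 1 e1 = 1.
Proof. by rewrite /e1 (tnth_nth 0) (coord_free 1 1 (basis_free basis_e)). Qed.

Definition coord_e := (coord_e00, coord_e01, coord_e10, coord_e11).

Lemma DformE m v : Dform m v = area (m v e0) (m v e1).
Proof. exact: lfun_det_area. Qed.

(** In the basis e, D_m is the diagonal of the bilinear map
    (u, v) |-> m(u, e_0) /\ m(v, e_1). *)
Lemma Dform_quad m : quad_forms V (Dform m).
Proof.
have [||b bE] := @bilinear_lfun F V F^o (fun u v => area (m u e0) (m v e1)).
- by move=> v a u u'; rewrite linearP !lfunE /= lfunE /= area_linearl.
- by move=> u a v v'; rewrite linearP !lfunE /= lfunE /= area_linearr.
by exists b => v; rewrite bE DformE.
Qed.

(** Once m(e_0, e_0) = a and m(e_0, e_1) = b are known, the coefficients a /\ c and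
    b /\ c of D_m determine c = m(e_1, e_1): by Cramer's rule they are, up to sign
    and division by the nonzero area a /\ b = D_m(e_0), its coordinates on the
    basis (a, b). *)
Lemma comm_algs_ext_Dform m m' :
  comm_algs V m -> comm_algs V m' -> Dform m = Dform m' ->
  Dform m e0 != 0 -> m e0 = m' e0 -> m = m'.
Proof.
move=> cm cm' DE; rewrite DformE => nz mE0.
pose a := m e0 e0; pose b := m e0 e1.
pose d := m e1 e1 - m' e1 e1.
have m10 : m e1 e0 = b by rewrite cm.
have m10' : m' e1 e0 = b by rewrite cm' -mE0.
have areaBr u v w : area u (v - w) = area u v - area u w.
  by rewrite -scaleN1r addrC area_linearr /GRing.scale /= mulN1r addrC.
have areaD u u' v w :
    area (u + u') (v + w) = area u v + area u w + (area u' v + area u' w).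
  by rewrite /area /wedge !linearD /=; ring.
(* D_m(e_1) is the area of (b, c). *)
have bd : area b d = 0.
  have := congr1 (fun q => q e1) DE.
  by rewrite !DformE m10 m10' areaBr => ->; rewrite subrr.
(* D_m(e_0 + e_1) is the sum of the areas of (a, b), (a, c) and (b, c). *)
have ad : area a d = 0.
  have := congr1 (fun q => q (e0 + e1)) DE.
  have mD (n : 'Hom(V, 'End(V))) v : n (e0 + e1) v = n e0 v + n e1 v.
    by rewrite linearD add_lfunE.
  rewrite !DformE !mD -!mE0 m10 m10' !areaD.
  move/eqP; rewrite -subr_eq0 => /eqP E.
  move: bd; rewrite !areaBr => bd; rewrite -[RHS]E -[LHS]addr0 -{}[in LHS]bd.
  by rewrite /a /b; ring.
have d0 : d = 0.
  have db : area d b = 0 by rewrite -[RHS]oppr0 -bd /area /wedge; ring.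
  apply/eqP; have := area_cramer a b d; rewrite db ad !scale0r addr0.
  by move/eqP; rewrite scaler_eq0 (negPf nz).
have mE1 : m e1 = m' e1.
  apply/lfunP => v; rewrite (coord_basis2 v) !(linearD, linearZ) /= m10 m10'.
  by move/subr0_eq: d0 => ->.
apply/lfunP => u; rewrite (coord_basis2 u).
by rewrite !linearD !linearZ /= mE0 mE1.
Qed.

(** With a = e_0 and b = alpha e_1, the equations a /\ c = beta and b /\ c = gamma
    read c_1 = beta and - alpha c_0 = gamma. *)
Lemma comm_algs_with_Dform q : quad_forms V q -> q e0 != 0 ->
  exists2 m, comm_algs V m & Dform m = q.
Proof.
move=> Qq nz; pose x := coord e 0; pose y := coord e 1.
pose al := q e0; pose be := q (e0 + e1) - q e0 - q e1; pose ga := q e1.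
pose c := - (ga / al) *: e0 + be *: e1.
have [||m mE] := @bilinear_lfun F V V (fun u v =>
  (x u * x v) *: e0 + (x u * y v + y u * x v) *: (al *: e1) + (y u * y v) *: c).
- move=> v a u u'; apply: plane_ext;
  by rewrite !(linearD, linearZ) /= /x /y !(linearD, linearZ) /= !coord_e; ring.
- move=> u a v v'; apply: plane_ext;
  by rewrite !(linearD, linearZ) /= /x /y !(linearD, linearZ) /= !coord_e; ring.
exists m => [u v|]; first by rewrite !mE; congr (_ *: _ + _ *: _ + _ *: _); ring.
apply/funext => u; rewrite DformE {3}(coord_basis2 u) quad_formE // !mE.
rewrite /area /wedge /c /x /y !(linearD, linearZ) /=.
rewrite !coord_e -/al -/be -/ga.
by field.
Qed.

End Plane.

(** * Algebras with a given determinant form *)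

Section Orbits.
Context {F : fieldType} {V : vectType F}.
Hypothesis dimV : \dim {:V} = 2%N.

Lemma basis_from (v : V) : v != 0 ->
  exists2 e : 2.-tuple V, basis_of {:V} e & tnth e 0 = v.
Proof.
move=> nz.
have /subvPn[w _ wv] : ~~ ({:V} <= <[v]>)%VS.
  by apply/negP => /dimvS; rewrite dimV dim_vline nz.
exists [tuple v; w] => //.
rewrite (@perm_basis _ _ _ [:: w; v]); last by rewrite (perm_catC [:: v]).
by rewrite basisEfree free_cons span_seq1 wv seq1_free nz subvf dimV.
Qed.

Lemma quad_form_nd_neq0 (q : V -> F) : Disc q <> 0 -> exists v, q v != 0.
Proof.
move=> nd; apply: contrapT => /forallNP q0; apply: nd.
have {}q0 v : q v = 0 by apply/eqP/negPn/negP/q0.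
do 4![apply/funext => ?].
by rewrite /Disc /Disc_in /disc_coef !q0 !subr0 expr0n mulr0 subr0 mul0r.
Qed.

Lemma quad_forms0 (q : V -> F) : quad_forms V q -> q 0 = 0.
Proof. by case=> b ->; rewrite linear0. Qed.

(** A form with nonzero discriminant takes a nonzero value at some vector; that
    vector is nonzero and starts a basis. *)
Lemma quad_form_basis (q : V -> F) : quad_forms V q -> Disc q <> 0 ->
  exists2 e : 2.-tuple V, basis_of {:V} e & q (tnth e 0) != 0.
Proof.
move=> Qq /quad_form_nd_neq0[v qv].
have [|e be ev] := @basis_from v; last by exists e; rewrite ?ev.
by apply: contraNneq qv => ->; rewrite quad_forms0.
Qed.

Lemma Dform_surj (q : V -> F) : quad_forms V q -> Disc q <> 0 ->
  exists2 m, comm_algs V m & Dform m = q.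
Proof.
by move=> Qq /(quad_form_basis Qq)[e be]; apply: (comm_algs_with_Dform be).
Qed.

(** The operator g = L'_(e_0) \o L_(e_0)^-1 is the only candidate, and its
    determinant is D_m'(e_0) / D_m(e_0) = 1. *)
Lemma Dform_inj (m m' : 'Hom(V, 'End(V))) :
  comm_algs V m -> comm_algs V m' -> Disc (Dform m) <> 0 ->
  Dform m = Dform m' -> exists2 g, SL V g & m' = alg_act g \1%VF m.
Proof.
move=> cm cm' nd DE.
have [e be De] := quad_form_basis (Dform_quad (vbasis2P dimV) m) nd.
set v := tnth e 0 in De.
have De' : Dform m' v != 0 by rewrite -DE.
pose g := (m' v \o (m v)^-1)%VF.
have Sg : SL V g.
  by rewrite /SL /= lfun_detM lfun_detV // -/(Dform m v) DE divff.
exists g => //; symmetry; apply: (comm_algs_ext_Dform be) => //.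
- exact: comm_algs_act.
- by rewrite Dform_act ?form_act1 //; apply: SL1.
- by rewrite Dform_act ?form_act1 //; apply: SL1.
apply/lfunP => w; rewrite alg_actE !inv_lfun1 /g comp_lfunE lker0_lfunK //.
exact: lfun_det_lker0.
Qed.

End Orbits.

Theorem proposition8p3 (F : fieldType) (V : vectType F)
    (char2 : 2%N \notin [pchar F]) (char3 : 3%N \notin [pchar F])
    (dimV : \dim {:V} = 2%N) :
  (forall m : 'Hom(V, 'End(V)), algs_D V m ->
     Dhat (alg_orbit m) = form_orbit (Dform m)) /\
  set_bij (algs_D_quot V) (quad_forms_nd_quot V) Dhat.
Proof.
split=> [m _|]; first exact: Dhat_orbit.
split.
- move=> _ [m [cm nd] <-]; exists (Dform m); last by rewrite Dhat_orbit.
  by split=> //; apply: Dform_quad (vbasis2P dimV) m.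
- move=> _ _ /set_mem[m [cm nd] <-] /set_mem[m' [cm' nd'] <-].
  rewrite !Dhat_orbit => Om.
  have [g Sg gE] : form_orbit (Dform m) (Dform m').
    by rewrite Om; apply: form_orbit_refl.
  rewrite -(Dform_act m SL1 Sg) in gE.
  have [|h Sh ->] := Dform_inj dimV (comm_algs_act \1%VF g cm) cm' _ gE.
    by rewrite gE.
  by rewrite !alg_orbit_act //; apply: SL1.
- move=> _ [q [Qq nd] <-]; have [m cm DE] := Dform_surj dimV Qq nd.
  exists (alg_orbit m); last by rewrite Dhat_orbit DE.
  by exists m => //; split; rewrite /= ?DE.
Qed.
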